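(* Let $Z=\mathbb{R}^K\times\mathbb{R}$ and let $\mathcal{P}$ be a statistical model on $Z^\infty$ equipped with an ATTS sequence of statistics $(S_n)$. Let $\mathcal{N}$ be a set of positive integers. Suppose the statistics $S_n$ are boundedly complete (with respect to $\mathcal{P}$) for $n\in\mathcal{N}$. If a confidence predictor $\Gamma$ is invariant and weakly valid for $n\in\mathcal{N}$, then there is a conformal predictor that is at least as accurate as $\Gamma$ for $n\in\mathcal{N}$.
   Context: The observation space is $Z=\mathbb{R}^K\times\mathbb{R}$, with observations $\zeta_n=(\mathbf{x}_n,y_n)$. A statistical model $\mathcal{P}$ on $Z^\infty$ is a family of probability distributions on $Z^\infty$. Let $S_n: Z^n\to\Sigma_n$, $n=1,2,\ldots$, be statistics (measurable maps into measurable spaces) with $\Sigma_n=S_n(Z^n)$. The sequence $(S_n)$ is algebraically transitive if there are measurable functions $F_n:\Sigma_{n-1}\times Z\to\Sigma_n$, $n=2,3,\ldots$, such that $S_n(\zeta_1,\ldots,\zeta_n)=F_n(S_{n-1}(\zeta_1,\ldots,\zeta_{n-1}),\zeta_n)$ for all $(\zeta_1,\ldots,\zeta_n)\in Z^n$. It is totally sufficient for $\mathcal{P}$ if, for each $n=1,2,\ldots$: (i) $S_n$ is sufficient for $\mathcal{P}$; (ii) for any $P\in\mathcal{P}$, if $(\zeta_1,\zeta_2,\ldots)\sim P$, then $(\zeta_1,\ldots,\zeta_n)$ and $(\zeta_{n+1},\zeta_{n+2},\ldots)$ are conditionally independent given $S_n(\zeta_1,\ldots,\zeta_n)$. An ATTS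 sequence is a sequence of statistics that is both algebraically transitive and totally sufficient for $\mathcal{P}$. Let $\Sigma_0$ be a fixed one-element set ($S_0$ of the empty sequence is its element). A statistic $S$ with values in a measurable space $\Sigma$ is boundedly complete (with respect to $\mathcal{P}$) if, for any bounded measurable $f:\Sigma\to\mathbb{R}$: $\mathbb{E}_P(f(S))=0$ for all $P\in\mathcal{P}$ only if $f(S)=0$ $P$-almost surely for all $P\in\mathcal{P}$. A confidence predictor $\Gamma$ is a measurable prediction strategy: for each $n$ and each significance level $\varepsilon\in(0,1)$ it outputs a set $\Gamma_n^\varepsilon=\Gamma^\varepsilon(\mathbf{x}_1,y_1,\ldots,\mathbf{x}_{n-1},y_{n-1},\mathbf{x}_n)\subseteq\mathbb{R}$ (measurability meaning that $\{(\mathbf{x}_1,y_1,\ldots,\mathbf{x}_n,y_n): y_n\in\Gamma_n^\varepsilon\}$ is measurable), and the sets are nested: $\Gamma_n^{\varepsilon_1}\subseteq\Gamma_n^{\varepsilon_2}$ whenever $\varepsilon_1>\varepsilon_2$. It makes an error at step $n$ at level $\varepsilon$ if $y_n\notin\Gamma_n^\varepsilon$. It is weakly valid for $n\in\mathcal{N}$ if, under any probability distribution in $\mathcal{P}$ and for all $n\in\mathcal{N}$ and $\varepsilon\in(0,1)$, the probability of an error at step $n$ at level $\varepsilon$ is $\varepsilon$. It is invariant if $\Gamma_n^\varepsilon$, $n>1$, depends on the first $n-1$ observations only through the value of $S_{n-1}$ on those observations. A confidence predictor $\Gamma^\dagger$ is at least as accurate as a confidence predictor $\Gamma$ for $n\in\mathcal{N}$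 if $(\Gamma^\dagger)^\varepsilon(\mathbf{x}_1,y_1,\ldots,\mathbf{x}_{n-1},y_{n-1},\mathbf{x}_n)\subseteq\Gamma^\varepsilon(\mathbf{x}_1,y_1,\ldots,\mathbf{x}_{n-1},y_{n-1},\mathbf{x}_n)$ for all $\varepsilon\in(0,1)$, all $n\in\mathcal{N}$, and $P$-almost all $\mathbf{x}_1,y_1,\ldots,\mathbf{x}_{n-1},y_{n-1},\mathbf{x}_n$, under any $P\in\mathcal{P}$. A nonconformity measure is any sequence of measurable functions $A_n:\Sigma_{n-1}\times Z\to\mathbb{R}$, $n=1,2,\ldots$. Given one, set $$p_n(\zeta_1,\ldots,\zeta_n,\tau_n):=\mathbb{P}(A_n^{\mathrm{rnd}}>A_n^{\mathrm{obs}}\mid S_n^{\mathrm{rnd}}=S_n^{\mathrm{obs}})+\tau_n\,\mathbb{P}(A_n^{\mathrm{rnd}}=A_n^{\mathrm{obs}}\mid S_n^{\mathrm{rnd}}=S_n^{\mathrm{obs}}),$$ where $A_n^{\mathrm{rnd}}:=A_n(S_{n-1}(\xi_1,\ldots,\xi_{n-1}),\xi_n)$, $S_n^{\mathrm{rnd}}:=S_n(\xi_1,\ldots,\xi_n)$, $A_n^{\mathrm{obs}}:=A_n(S_{n-1}(\zeta_1,\ldots,\zeta_{n-1}),\zeta_n)$, $S_n^{\mathrm{obs}}:=S_n(\zeta_1,\ldots,\zeta_n)$; here the $\zeta_i$ are treated as fixed, and the probabilities are over $(\xi_1,\xi_2,\ldots)\sim P$ for some $P\in\mathcal{P}$. Since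 $S_n$ is sufficient, the regular conditional probabilities are chosen so that $p_n$ does not depend on $P\in\mathcal{P}$. A conformal predictor is a confidence predictor of the form $$\Gamma^\varepsilon(\mathbf{x}_1,y_1,\ldots,\mathbf{x}_{n-1},y_{n-1},\mathbf{x}_n):=\{y\in\mathbb{R}: p_n((\mathbf{x}_1,y_1),\ldots,(\mathbf{x}_{n-1},y_{n-1}),(\mathbf{x}_n,y),1)>\varepsilon\}$$ for some nonconformity measure $(A_n)$.
   Formalization: Invariance is read measurably: the prediction set is a function of S_{n-1} and the new object with measurable graph (automatic for standard Borel Σ_n; the claim fails otherwise). The version of the conditional probabilities common to the model is chosen with the conformal predictor. *)

(* Defs.v *)
(* MathComp-Analysis *)
From mathcomp Require Import all_boot all_order all_algebra.
From mathcomp Require Import all_classical all_reals all_analysis.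
Set Implicit Arguments.
Unset Strict Implicit.
Unset Printing Implicit Defensive.
Import Order.TTheory GRing.Theory Num.Theory.
Import numFieldNormedType.Exports.
Local Open Scope classical_set_scope.
Local Open Scope ring_scope.

Notation obs R K := (K.-tuple R * R)%type.

Section Paths.
Context (R : realType) (K : nat).
Local Notation Z := (obs R K).

Definition cylinders : set (set (nat -> Z)) :=
  [set C | exists i (B : set Z), measurable B /\ C = [set w | B (w i)]].

(* A path [w] lists zeta_1, zeta_2, ... as [w 0], [w 1], ... *)
Local Notation paths := (g_sigma_algebraType cylinders).

Definition initial (n : nat) (w : paths) : n.-tuple Z := [tuple w i | i < n].

Definition future (n : nat) (w : paths) : paths := fun i => w (n + i)%N.

Definition past (m : nat) (t : m.+1.-tuple Z) : m.-tuple Z :=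
  [tuple tnth t (widen_ord (leqnSn m) i) | i < m].

Definition current (m : nat) (t : m.+1.-tuple Z) : Z := tnth t ord_max.

(* A model is a set of distributions on Z^oo. *)
Definition model := set (probability paths R).

End Paths.

Notation paths R K := (g_sigma_algebraType (@cylinders R K)).

Section Statistics.
Context (R : realType) (K : nat) (d : nat -> measure_display).
Context (Sigma : forall n, measurableType (d n)).
Context (PP : model R K).
Context (S : forall n, n.-tuple (obs R K) -> Sigma n).
Local Notation Z := (obs R K).

Definition stat (n : nat) (w : paths R K) : Sigma n := S (initial n w).

(* For n = 0 surjectivity says that Sigma_0 has exactly one element. *)
Definition statistics : Prop :=
  forall n, measurable_fun setT (@S n) /\ range (@S n) = setT.

Definition algebraically_transitive : Prop :=
  forall m, (0 < m)%N ->
    exists2 F : Sigma m * Z -> Sigma m.+1, measurable_fun setT F &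
      forall t : m.+1.-tuple Z, S t = F (S (past t), current t).

(* [k] is a regular version, common to all P in the model, of the conditional
   distribution of (zeta_1, ..., zeta_n) given S_n. *)
Definition common_regular_conditional (n : nat)
    (k : R.-pker (Sigma n) ~> (n.-tuple Z)) : Prop :=
  forall P, PP P ->
  forall (A : set (n.-tuple Z)) (B : set (Sigma n)),
    measurable A -> measurable B ->
    P (initial n @^-1` A `&` stat n @^-1` B) =
    (\int[P]_(w in stat n @^-1` B) k (stat n w) A)%E.

Definition sufficient (n : nat) : Prop :=
  exists k : R.-pker (Sigma n) ~> (n.-tuple Z), common_regular_conditional k.

(* [h] is a version of the conditional probability s |-> P(E | S_n = s). *)
Definition conditional_probability (P : probability (paths R K) R) (n : nat)
    (E : set (paths R K)) (h : Sigma n -> R) : Prop :=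
  measurable_fun setT h /\
  forall B : set (Sigma n), measurable B ->
    P (E `&` stat n @^-1` B) =
    (\int[P]_(w in stat n @^-1` B) (h (stat n w))%:E)%E.

Definition past_future_independent (P : probability (paths R K) R) (n : nat)
    : Prop :=
  forall (A : set (n.-tuple Z)) (B : set (paths R K)),
    measurable A -> measurable B ->
    exists hA hB : Sigma n -> R,
      [/\ conditional_probability P (initial n @^-1` A) hA,
          conditional_probability P (future n @^-1` B) hB &
          conditional_probability P (initial n @^-1` A `&` future n @^-1` B)
            (fun s => hA s * hB s)].

Definition totally_sufficient : Prop :=
  forall n, (0 < n)%N ->
    sufficient n /\ forall P, PP P -> past_future_independent P n.

Definition ATTS : Prop :=
  [/\ statistics, algebraically_transitive & totally_sufficient].

Definition boundedly_complete (n : nat) : Prop :=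
  forall f : Sigma n -> R,
    measurable_fun setT f ->
    (exists M : R, forall s, `|f s| <= M) ->
    (forall P, PP P -> ('E_P[fun w => f (stat n w)] = 0)%E) ->
    forall P, PP P -> {ae P, forall w, f (stat n w) = 0}.

(* [G m t x e] is the prediction set for the label at step n = m + 1, given the
   past observations [t] and the new object [x], at significance level [e];
   only its values for 0 < e < 1 are meaningful. *)
Definition predictor :=
  forall m : nat, m.-tuple Z -> K.-tuple R -> R -> set R.

Implicit Types G : predictor.

Definition confidence_predictor G : Prop :=
  (forall m (e : R), 0 < e < 1 ->
     measurable [set t : m.+1.-tuple Z |
       G m (past t) (current t).1 e (current t).2]) /\
  (forall m (t : m.-tuple Z) (x : K.-tuple R) (e1 e2 : R),
     0 < e1 < 1 -> 0 < e2 < 1 -> e2 < e1 -> G m t x e1 `<=` G m t x e2).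

Definition error_event G (m : nat) (e : R) : set (paths R K) :=
  [set w | ~ G m (initial m w) (w m).1 e (w m).2].

Definition weakly_valid (N : set nat) G : Prop :=
  forall P, PP P -> forall m, N m.+1 -> forall e : R, 0 < e < 1 ->
    P (error_event G m e) = e%:E.

(* Dependence only through S_(n-1) is understood measurably, like
   measurability of predictors: the prediction set is a function [H] of S_(n-1)
   and of the new object, with a measurable graph.  For a general measurable
   space Sigma_(n-1), a function of S_(n-1) which is measurable on Z^(n-1)
   need not be measurable on Sigma_(n-1). *)
Definition invariant_predictor G : Prop :=
  forall m, (0 < m)%N -> forall e : R, 0 < e < 1 ->
    exists2 H : Sigma m -> K.-tuple R -> set R,
      measurable [set u : Sigma m * Z | H u.1 u.2.1 u.2.2] &
      forall t x, G m t x e = H (S t) x.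

Definition at_least_as_accurate (N : set nat) G' G : Prop :=
  forall e : R, 0 < e < 1 -> forall m, N m.+1 -> forall P, PP P ->
    {ae P, forall w,
      G' m (initial m w) (w m).1 e `<=` G m (initial m w) (w m).1 e}.

(* [A m] is the n-th nonconformity function for n = m + 1. *)
Definition nonconformity_measure (A : forall m, Sigma m * Z -> R) : Prop :=
  forall m, measurable_fun setT (A m).

Definition score (A : forall m, Sigma m * Z -> R) (m : nat)
    (t : m.+1.-tuple Z) : R :=
  A m (S (past t), current t).

Definition pvalue (k : forall m, R.-pker (Sigma m.+1) ~> (m.+1.-tuple Z))
    (A : forall m, Sigma m * Z -> R)
    (m : nat) (t : m.+1.-tuple Z) (tau : R) : \bar R :=
  (k m (S t) [set u | (score A u > score A t)%R] +
   tau%:E * k m (S t) [set u | score A u = score A t])%E.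

(* The regular conditional probabilities are determined only up to null sets of
   values of S_n; fixing a version common to the whole model is part of the
   choice of a conformal predictor. *)
Definition conformal_predictor G : Prop :=
  confidence_predictor G /\
  exists (k : forall m, R.-pker (Sigma m.+1) ~> (m.+1.-tuple Z))
         (A : forall m, Sigma m * Z -> R),
    [/\ forall m, common_regular_conditional (k m),
        nonconformity_measure A &
        forall m (t : m.-tuple Z) (x : K.-tuple R) (e : R), 0 < e < 1 ->
          G m t x e =
          [set y | (e%:E < pvalue k A [tuple of rcons t (x, y)] 1)%E]].

End Statistics.

(* Main.v *)
From HB Require Import structures.
Require Import Defs.
From mathcomp Require Import all_boot all_order all_algebra.
From mathcomp Require Import all_classical all_reals all_analysis.
From mathcomp Require Import measurable_realfun.
Set Implicit Arguments.
Unset Strict Implicit.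
Unset Printing Implicit Defensive.
Import Order.TTheory GRing.Theory Num.Theory.
Import numFieldNormedType.Exports.
Local Open Scope classical_set_scope.

(** Every observation at step n is assigned the smallest level at which G errs
    on it, its critical level ([critical_level]); by invariance this is a
    function of S_(n-1) and of the observation alone, so its opposite is a
    nonconformity function.  The claim is that the conformal predictor it
    defines dominates G.

    Fix a level e and let E be the event that G errs at step n at level e.
    Weak validity says that the conditional probability of E given S_n has
    mean e under every P in the model, so bounded completeness forces it to be
    equal to e almost surely ([complete_conditional_probability]).  Doing this
    for all rational e at once, given almost every value of S_n the critical
    level is stochastically at least as large as a uniform variable
    ([critical_level_superuniform]).  The conformal p-value of an observation
    is the conditional probability of a critical level not above its own; hence
    if G errs on the observation at level e, its critical level is at most e,
    and so is its p-value: the conformal predictor errs as well.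

    The exceptional null set of values of S_n cannot be discarded at the end,
    because the inclusion of prediction sets is required for all labels y,
    while an almost sure statement about S_n only concerns almost all of them.
    It is removed at the start instead: the regular conditional probability is
    determined only up to null sets of values of S_n, and
    [exists_calibrated_kernel] redirects the exceptional values to one good
    value.  With this version the inclusion holds everywhere
    ([exists_dominating_pvalue]). *)

(** * Kernels and countable families *)

Section PullbackKernel.
Local Open Scope ring_scope.
Local Open Scope ereal_scope.
Context d1 d2 d3 (X : measurableType d1) (Y : measurableType d2)
  (T : measurableType d3) (R : realType).
Variables (k : R.-pker Y ~> T) (f : X -> Y).

Definition kpullback (mf : measurable_fun setT f) (x : X) :
  {measure set T -> \bar R} := k (f x).

Hypothesis mf : measurable_fun setT f.

Let measurable_kpullback U : measurable U ->
  measurable_fun [set: X] (kpullback mf ^~ U).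
Proof. by move=> mU; apply: measurableT_comp (measurable_kernel k U mU) mf. Qed.

HB.instance Definition _ := isKernel.Build _ _ _ _ _ (kpullback mf)
  measurable_kpullback.

Let kpullback_prob x : kpullback mf x setT = 1.
Proof. exact: prob_kernel. Qed.

HB.instance Definition _ := Kernel_isProbability.Build _ _ _ _ _
  (kpullback mf) kpullback_prob.

End PullbackKernel.
Arguments kpullback {d1 d2 d3 X Y T R} k {f} mf x.

Lemma measurable_bigcup_countType d (T : measurableType d) (I : countType)
    (J : set I) (F : I -> set T) :
  (forall i, J i -> measurable (F i)) -> measurable (\bigcup_(i in J) F i).
Proof.
move=> mF; rewrite bigcup_mkcond; apply: countable_bigcupT_measurable => // i.
by case: ifPn => //; rewrite inE => /mF.
Qed.

Lemma ae_forall_countType d (T : measurableType d) (R : realType)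
    (mu : {measure set T -> \bar R}%R) (I : countType) (Q : I -> T -> Prop) :
  (forall i, {ae mu, forall x, Q i x}) -> {ae mu, forall x, forall i, Q i x}.
Proof.
move=> muQ.
have : {ae mu, forall x, forall n : nat,
    if @unpickle I n is Some i then Q i x else True}.
  apply: ae_foralln => n; case: (unpickle n) => [i|]; first exact: muQ.
  exact: aeW.
move=> [N [mN muN sub]]; exists N; split => // x /= nQ; apply: sub => /= h.
by apply: nQ => i; have := h (pickle i); rewrite pickleK.
Qed.

(** * Past and current observations *)

Section Tuples.
Context (R : realType) (K : nat).
Local Notation Z := (obs R K).

Lemma past_rcons m (t : m.-tuple Z) (z : Z) :
  past [tuple of rcons t z] = t.
Proof.
apply: eq_from_tnth => i.
by rewrite tnth_mktuple !(tnth_nth z) /= nth_rcons size_tuple ltn_ord.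
Qed.

Lemma current_rcons m (t : m.-tuple Z) (z : Z) :
  current [tuple of rcons t z] = z.
Proof. by rewrite /current (tnth_nth z) /= nth_rcons size_tuple ltnn eqxx. Qed.

Lemma rcons_past_current m (t : m.+1.-tuple Z) :
  [tuple of rcons (past t) (current t)] = t.
Proof.
apply: eq_from_tnth => i; have [im|im] := ltnP i m.
  have -> : i = widen_ord (leqnSn m) (Ordinal im) by exact/val_inj.
  rewrite -[RHS](tnth_mktuple (fun j => tnth t (widen_ord (leqnSn m) j))).
  rewrite -/(past t); move: (past t) => p.
  by rewrite !(tnth_nth (current t)) /= nth_rcons size_tuple im.
have -> : i = ord_max.
  by apply/val_inj/eqP; rewrite eqn_leq /= im -ltnS ltn_ord.
exact: current_rcons.
Qed.

Lemma past_initial m (w : paths R K) : past (initial m.+1 w) = initial m w.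
Proof. by apply: eq_from_tnth => i; rewrite !tnth_mktuple. Qed.

Lemma current_initial m (w : paths R K) : current (initial m.+1 w) = w m.
Proof. by rewrite /current tnth_mktuple. Qed.

Lemma measurable_past m : measurable_fun setT (@past R K m).
Proof.
apply/measurable_fun_tnthP => i.
rewrite (_ : _ \o _ = fun t : m.+1.-tuple Z => tnth t (widen_ord (leqnSn m) i)).
  exact: measurable_tnth.
by apply/funext => t /=; rewrite tnth_mktuple.
Qed.

Lemma measurable_current m : measurable_fun setT (@current R K m).
Proof. exact: measurable_tnth. Qed.

Lemma measurable_initial n : measurable_fun setT (@initial R K n).
Proof.
apply/measurable_fun_tnthP => i.
rewrite (_ : _ \o _ = fun w : paths R K => w i); last first.
  by apply/funext => w /=; rewrite tnth_mktuple.
move=> _ B mB; rewrite setTI; apply: sub_sigma_algebra.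
by exists (i : nat), B.
Qed.

End Tuples.

(** * The critical level of an increasing family of events *)

Section CriticalLevel.
Local Open Scope ring_scope.
Context d (T : measurableType d) (R : realType) (E : R -> set T).

(** When E is increasing, this is the infimum of the levels e in (0, 1) such
    that u lies in E e, and 1 if there are none.  Only rational levels enter so
    that measurability and almost sure statements involve countably many
    events. *)
Definition critical_level (u : T) : R :=
  inf ([set 1] `|` [set ratr r | r in
         [set r : rat | 0 < (ratr r : R) < 1 /\ E (ratr r) u]]).

Lemma critical_level_lt u a : critical_level u < a <->
  1 < a \/ exists r : rat, [/\ 0 < (ratr r : R) < 1, ratr r < a & E (ratr r) u].
Proof.
rewrite /critical_level; set V := (X in inf X).
have lbV : lbound V 0.
  by move=> _ [->//|[r [/andP[/ltW r0 _] _] <-]].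
have hV : has_inf V by split; [exists 1; left | exists 0].
split=> [/(inf_lt hV.1)[_ [->|[r [r01 Er] <-] ra]]|[a1|[r [r01 ra Er]]]].
- by left.
- by right; exists r.
- by apply: le_lt_trans a1; apply: ge_inf; [exact: hV.2|left].
- by apply: le_lt_trans ra; apply: ge_inf; [exact: hV.2|right; exists r].
Qed.

Lemma measurable_critical_level :
  (forall e, 0 < e < 1 -> measurable (E e)) ->
  measurable_fun setT critical_level.
Proof.
move=> mE; apply: (measurability _ (RGenInftyO.measurableE R)) => //.
move=> _ [_ [a ->] <-]; rewrite setTI.
rewrite (_ : _ @^-1` _ = [set _ | 1 < a] `|` \bigcup_(r in [set r : rat |
    0 < (ratr r : R) < 1 /\ ratr r < a]) E (ratr r)).
  apply: measurableU.
    case: (1 < a); first by rewrite (_ : [set _ | _] = setT)//; apply/seteqP; split.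
    by rewrite (_ : [set _ | _] = set0)//; apply/seteqP; split.
  by apply: measurable_bigcup_countType => r [r01 _]; exact: mE.
apply/seteqP; split=> u /=; rewrite in_itv /=.
  by move=> /critical_level_lt[?|[r [? ? ?]]]; [left|right; exists r].
move=> h; apply/critical_level_lt; case: h => [|[r [? ?] ?]]; first by left.
by right; exists r.
Qed.

Hypothesis E_incr : forall e1 e2, 0 < e1 < 1 -> 0 < e2 < 1 -> e1 < e2 ->
  E e1 `<=` E e2.

Lemma critical_level_le e u : 0 < e < 1 -> E e u -> critical_level u <= e.
Proof.
move=> /andP[e0 e1] Eu; rewrite leNgt; apply/negP => lt_e.
have : e < Num.min (critical_level u) 1 by rewrite lt_min lt_e.
move=> /rat_in_itvoo[r]; rewrite in_itv /= lt_min => /and3P[er rc r1].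
have r01 : 0 < (ratr r : R) < 1 by rewrite r1 (lt_trans e0).
suff : critical_level u < critical_level u by rewrite ltxx.
apply/critical_level_lt; right; exists r; split=> //.
by apply: (E_incr _ _ er) Eu; rewrite // e0.
Qed.

(** The event that the critical level is at most a lies in E r for every rational
    r > a, since a critical level smaller than r is witnessed by some r' < r. *)
Lemma critical_level_superuniform (mu : {measure set T -> \bar R}) :
  (forall e, 0 < e < 1 -> measurable (E e)) ->
  (forall r : rat, 0 < (ratr r : R) < 1 ->
    (mu (E (ratr r)) <= (ratr r)%:E)%E) ->
  forall a, 0 < a < 1 -> (mu [set u | (critical_level u <= a)%R] <= a%:E)%E.
Proof.
move=> mE muE a /andP[a0 a1].
have mC : measurable [set u | critical_level u <= a].
  rewrite -[X in measurable X]setTI.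
  have := measurable_critical_level mE measurableT (measurable_itv `]-oo, a]).
  by congr (measurable (_ `&` _)); apply/seteqP; split=> u /=; rewrite in_itv.
apply/lee_addgt0Pr => eps eps0.
have : a < Num.min (a + eps) 1 by rewrite lt_min a1 ltrDl eps0.
move=> /rat_in_itvoo[r]; rewrite in_itv /= lt_min => /and3P[ar re r1].
have r01 : 0 < (ratr r : R) < 1 by rewrite r1 (lt_trans a0).
apply: (@le_trans _ _ (ratr r)%:E); last by rewrite -EFinD lee_fin ltW.
apply: le_trans (muE _ r01); apply: le_measure; rewrite ?inE //; first exact: mE.
move=> u /= ua.
have /critical_level_lt[|[r' [r'01 r'r Eu]]] : critical_level u < ratr r.
- exact: le_lt_trans ar.
- by move=> /(lt_trans r1); rewrite ltxx.
- exact: E_incr Eu.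
Qed.

End CriticalLevel.

(** * Conformal p-values and prediction sets *)

Section ConformalPrediction.
Local Open Scope ring_scope.
Context (R : realType) (K : nat) (d : nat -> measure_display).
Context (Sigma : forall n, measurableType (d n)).
Context (S : forall n, n.-tuple (obs R K) -> Sigma n).
Hypothesis mS : forall n, measurable_fun setT (@S n).
Local Notation Z := (obs R K).

Lemma measurable_summary m : measurable_fun setT
  (fun t : m.+1.-tuple Z => (S (past t), current t)).
Proof.
apply: measurable_fun_pair; last exact: measurable_current.
exact: measurableT_comp (@mS _) (@measurable_past _ _ _).
Qed.

Section Pvalue.
Variables (k : forall m, R.-pker (Sigma m.+1) ~> (m.+1.-tuple Z))
  (A : forall m, Sigma m * Z -> R).
Hypothesis mA : nonconformity_measure A.

Lemma measurable_score m : measurable_fun setT (@score R K d Sigma S A m).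
Proof. exact: measurableT_comp (@mA m) (@measurable_summary m). Qed.

Lemma pvalue1E m (t : m.+1.-tuple Z) :
  pvalue S k A t 1 = k m (S t) [set u | score S A t <= score S A u].
Proof.
have ms := @measurable_score m.
rewrite /pvalue mul1e -measureU.
- congr (k m (S t) _); apply/seteqP; split=> u /=.
    by case=> [/ltW//|->].
  by rewrite le_eqVlt => /orP[/eqP->|]; [right|left].
- rewrite -[X in measurable X]setTI.
  have := ms measurableT _ (measurable_itv `]score S A t, +oo[).
  by congr (measurable (_ `&` _)); apply/seteqP; split=> u /=;
    rewrite in_itv /= andbT.
- rewrite -[X in measurable X]setTI.
  exact: ms measurableT _ (measurable_set1 (score S A t)).
- by apply/seteqP; split => // u /= [] /[swap] ->; rewrite ltxx.
Qed.

Definition conformal_set : predictor R K :=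
  fun m t x e => [set y | (e%:E < pvalue S k A [tuple of rcons t (x, y)] 1)%E].

(** The kernel at S t is evaluated at a set that itself depends on t, a section
    of the measurable set W below: this is the measurability of the measures of
    sections under a kernel, applied to the pullback of k along S. *)
Lemma measurable_pvalue1 m :
  measurable_fun setT (fun t : m.+1.-tuple Z => pvalue S k A t 1).
Proof.
pose W := [set v : m.+1.-tuple Z * m.+1.-tuple Z |
  score S A v.1 <= score S A v.2].
have mW : measurable W.
  rewrite -[W]setTI; apply: measurable_fun_le => //.
  - exact: measurableT_comp (@measurable_score m) measurable_fst.
  - exact: measurableT_comp (@measurable_score m) measurable_snd.
pose kS : R.-pker (m.+1.-tuple Z) ~> (m.+1.-tuple Z) := kpullback (k m) (@mS _).
have : measurable_fun setT (fun t => kS t (xsection W t)).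
  apply: measurable_fun_xsection_finite_kernel; exact/mem_set.
congr measurable_fun; apply/funext => t.
rewrite pvalue1E /=; congr (k m (S t) _).
by apply/seteqP; split=> u /=; rewrite /xsection /= inE.
Qed.

Lemma conformal_set_confidence : confidence_predictor conformal_set.
Proof.
split=> [m e _|m t x e1 e2 _ _ e21 y /=]; last first.
  by apply: lt_trans; rewrite lte_fin.
rewrite (_ : [set _ | _] = [set t : m.+1.-tuple Z |
    (e%:E < pvalue S k A t 1)%E]).
  rewrite -[X in measurable X]setTI.
  exact: emeasurable_fun_o_infty (@measurable_pvalue1 m) _.
by apply/seteqP; split => t /=;
  rewrite /conformal_set /= -surjective_pairing rcons_past_current.
Qed.

End Pvalue.

(** * Completeness and calibrated conditional probabilities *)

Section Calibration.
Variable PP : model R K.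

Lemma measurable_stat n : measurable_fun setT (@stat R K d Sigma S n).
Proof. exact: measurableT_comp (@mS n) (@measurable_initial R K n). Qed.

(** The conditional probability of A minus its constant mean c is a bounded
    function of S_n with zero expectation under the whole model, so bounded
    completeness makes it vanish. *)
Lemma complete_conditional_probability n (k : R.-pker (Sigma n) ~> (n.-tuple Z))
    (A : set (n.-tuple Z)) (c : R) :
  boundedly_complete PP S n -> common_regular_conditional PP S k ->
  measurable A -> (forall P, PP P -> P (@initial R K n @^-1` A) = c%:E) ->
  forall P, PP P -> {ae P, forall w, k (stat S n w) A = c%:E}.
Proof.
move=> compl reg mA PA.
have mkA := measurable_kernel k A mA.
have kA1 s : (k s A <= 1)%E.
  by apply: le_trans (sprob_kernel_le1 k s); rewrite le_measure ?inE.
have finkA s : k s A \is a fin_num.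
  by rewrite ge0_fin_numE// (le_lt_trans (kA1 s)) ?ltry.
have kA01 s : 0 <= fine (k s A) <= 1.
  by rewrite fine_ge0// -lee_fin fineK//=.
pose g s := fine (k s A).
have mg : measurable_fun setT g by exact: measurableT_comp mkA.
have mf : measurable_fun setT (fun s => g s - c) by exact: measurable_funB.
have fb : exists M : R, forall s, `|g s - c| <= M.
  exists (1 + `|c|) => s; apply: le_trans (ler_normB _ _) _.
  by rewrite lerD2r; have /andP[? ?] := kA01 s; rewrite ger0_norm.
have f0 P : PP P -> ('E_P[fun w => (g (stat S n w) - c)%R] = 0)%E.
  move=> PPP; rewrite unlock.
  have Pfin : (P setT < +oo)%E by rewrite probability_setT ltry.
  under eq_integral do rewrite EFinB.
  rewrite integralB_EFin//=.
  - under eq_integral do rewrite /g fineK//.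
    have := reg P PPP A setT mA measurableT.
    rewrite preimage_setT setIT PA// => kc.
    by rewrite integral_cst//= probability_setT mule1 -kc subee//.
  - apply: measurable_bounded_integrable => //.
      exact: measurableT_comp mg (@measurable_stat n).
    exists 1; split => // x x1 w _ /=.
    have /andP[? ?] := kA01 (stat S n w).
    by rewrite ger0_norm// (le_trans _ (ltW x1)).
  - exact: finite_measure_integrable_cst.
move=> P PPP; have [N [mN PN sub]] := compl _ mf fb f0 P PPP.
exists N; split => // w /= kw; apply: sub => /= /eqP.
by rewrite subr_eq0 => /eqP gc; apply: kw; rewrite -gc fineK.
Qed.

(** The values s of S_n at which k s gives some E i a probability other than c i
    form a null set B under every distribution in the model.  Since the model
    is nonempty, some s0 lies outside B; replacing k s by k s0 for all s in B
    changes k only on a null set, so the result is still a common regular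
    conditional distribution, and it now satisfies the equations at every s. *)
Lemma exists_calibrated_kernel n (I : countType) (J : set I)
    (E : I -> set (n.-tuple Z)) (c : I -> R) :
  boundedly_complete PP S n -> sufficient PP S n -> PP !=set0 ->
  (forall i, J i -> measurable (E i)) ->
  (forall i, J i -> forall P, PP P -> P (@initial R K n @^-1` E i) = (c i)%:E) ->
  exists2 k : R.-pker (Sigma n) ~> (n.-tuple Z),
    common_regular_conditional PP S k &
    forall s i, J i -> k s (E i) = (c i)%:E.
Proof.
move=> compl [k reg] [P0 PP0] mE PE.
pose B := \bigcup_(i in J) [set s | k s (E i) != (c i)%:E].
have mB : measurable B.
  apply: measurable_bigcup_countType => i Ji; rewrite -[X in measurable X]setTI.
  by apply: emeasurable_neq => //; exact: measurable_kernel (mE i Ji).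
have aeB P : PP P -> {ae P, forall w, ~ B (stat S n w)}.
  move=> PPP.
  have : {ae P, forall w, forall i, J i -> k (stat S n w) (E i) = (c i)%:E}.
    apply: ae_forall_countType => i; have [Ji|nJi] := pselect (J i).
      have := complete_conditional_probability compl reg (mE i Ji) (PE i Ji) PPP.
      move=> [N [mN PN sub]]; exists N; split => // w /= kw; apply: sub => /= h.
      by apply: kw.
    by apply: aeW.
  move=> [N [mN PN sub]]; exists N; split => // w /= nB; apply: sub => /= h.
  by apply: nB => -[i Ji /= /eqP]; apply; exact: h.
have [s0 nBs0] : exists s0, ~ B s0.
  apply: contrapT => /forallNP allB.
  have [N [mN PN sub]] := aeB _ PP0.
  have : P0 N = 1%E.
    rewrite -(probability_setT P0); congr (P0 _); apply/seteqP; split=> // w _.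
    by apply: sub => /= nBw; exact: allB nBw.
  by rewrite PN => /esym/eqP; rewrite onee_eq0.
pose phi s := if s \in B then s0 else s.
have mphi : measurable_fun setT phi.
  apply: measurable_fun_ifT => //; apply: (measurable_fun_bool true).
  rewrite setTI (_ : _ @^-1` _ = B)//.
  by apply/seteqP; split=> s /=; [move/set_mem|move/mem_set].
have nBphi s : ~ B (phi s).
  by rewrite /phi; case: ifPn => // /negP nB Bs; apply: nB; rewrite inE.
exists (kpullback k mphi); last first.
  move=> s i Ji; apply: contrapT => /eqP nE.
  by apply: (nBphi s); exists i.
move=> P PPP A C mA mC; rewrite (reg P PPP A C mA mC).
have mstat := @measurable_stat n.
have mkA := measurable_kernel k A mA.
apply: ge0_ae_eq_integral => //.
- by rewrite -[X in measurable X]setTI; exact: mstat.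
- by apply: measurable_funTS; exact: measurableT_comp mkA mstat.
- apply: measurable_funTS.
  exact: measurableT_comp mkA (measurableT_comp mphi mstat).
- have [N [mN PN sub]] := aeB _ PPP.
  exists N; split => // w /= kw; apply: sub => /= nBw; apply: kw => _.
  by rewrite /kpullback /phi memNset.
Qed.

End Calibration.

(** * A conformal predictor dominating an invariant one *)

Section Dominance.
Variables (PP : model R K) (G : predictor R K).
Arguments G : clear implicits.
Hypotheses (hG : confidence_predictor G) (hinv : invariant_predictor S G).

(** The first step, where there is no past, is outside the scope of invariance;
    the prediction set is then trivially a function of the empty past. *)
Lemma measurable_invariant_set m (e : R) : 0 < e < 1 ->
  exists2 H : Sigma m -> K.-tuple R -> set R,
    measurable [set u : Sigma m * Z | H u.1 u.2.1 u.2.2] &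
    forall t x, G m t x e = H (S t) x.
Proof.
case: m => [|m] e01; last exact: hinv.
exists (fun _ x => G 0 [tuple] x e); last by move=> t x; rewrite (tuple0 t).
pose sing (u : Sigma 0 * Z) : 1.-tuple Z := [tuple u.2].
have msing : measurable_fun setT sing.
  apply/measurable_fun_tnthP => i.
  rewrite (_ : _ \o _ = snd)//; apply/funext => u /=.
  by rewrite ord1.
have := msing measurableT _ (hG.1 0 e e01); rewrite setTI.
congr measurable; apply/seteqP; split => u /=;
  by rewrite (tuple0 (past _)).
Qed.

(** The nonconformity function a is the opposite of the critical level of the
    errors of G, so the set whose measure is taken is the set of those u with
    critical level at most that of t.  The hypotheses on the model and on G only
    enter the bound, so that a and k exist at all steps, including those where
    completeness or validity is not assumed. *)
Lemma exists_dominating_pvalue m :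
  sufficient PP S m.+1 ->
  exists (a : Sigma m * Z -> R) (k : R.-pker (Sigma m.+1) ~> (m.+1.-tuple Z)),
    [/\ measurable_fun setT a, common_regular_conditional PP S k &
      PP !=set0 -> boundedly_complete PP S m.+1 ->
      (forall P, PP P -> forall e : R, 0 < e < 1 ->
         P (error_event G m e) = e%:E) ->
      forall (t : m.+1.-tuple Z) (e : R), 0 < e < 1 ->
        ~ G m (past t) (current t).1 e (current t).2 ->
        (k (S t) [set u | (a (S (past t), current t) <=
                             a (S (past u), current u))%R] <= e%:E)%E].
Proof.
move=> suffS.
(* Choosing H for all e at once requires a dummy value outside (0, 1). *)
have /choice[H HP] : forall e : R, exists H : Sigma m -> K.-tuple R -> set R,
    0 < e < 1 ->
    measurable [set u : Sigma m * Z | H u.1 u.2.1 u.2.2] /\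
    forall t x, G m t x e = H (S t) x.
  move=> e; have [e01|ne01] := pselect (0 < e < 1); last first.
    by exists (fun _ _ => set0) => /ne01.
  by have [H mH GH] := measurable_invariant_set m e01; exists H.
pose E (e : R) := ~` [set u : Sigma m * Z | H e u.1 u.2.1 u.2.2].
pose summary (t : m.+1.-tuple Z) := (S (past t), current t).
(* E lives on Sigma m * Z, where a must be defined; F, its pullback to tuples, is
   the error event of G, and it inherits monotonicity in e from G. *)
pose F e := summary @^-1` E e.
have mE e : 0 < e < 1 -> measurable (E e).
  by move=> e01; apply: measurableC; exact: (HP e e01).1.
have mF e : 0 < e < 1 -> measurable (F e).
  move=> e01; rewrite -[F e]setTI.
  have ms := @measurable_summary m; exact: ms measurableT _ (mE e e01).
have FE e t : 0 < e < 1 ->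
    F e t <-> ~ G m (past t) (current t).1 e (current t).2.
  by move=> e01; rewrite /F /E /= (HP e e01).2.
have F_incr e1 e2 : 0 < e1 < 1 -> 0 < e2 < 1 -> e1 < e2 -> F e1 `<=` F e2.
  move=> e101 e201 e12 t /(FE _ _ e101) nG; apply/(FE _ _ e201).
  by apply: contra_not nG; exact: hG.2.
have initialF P e : 0 < e < 1 ->
    P (@initial R K m.+1 @^-1` F e) = P (error_event G m e) :> \bar R.
  move=> e01; congr (P _); apply/seteqP; split => w /=.
    by move=> /(FE _ _ e01); rewrite past_initial current_initial.
  by move=> ?; apply/(FE _ _ e01); rewrite past_initial current_initial.
exists (fun u => - critical_level E u).
have ma : measurable_fun setT (fun u => - critical_level E u).
  exact: measurableT_comp (measurable_critical_level mE).
have [[PP0 compl valid]|nPP] := pselect [/\ PP !=set0,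
    boundedly_complete PP S m.+1 &
    forall P, PP P -> forall e : R, 0 < e < 1 -> P (error_event G m e) = e%:E];
  last first.
  by have [k reg] := suffS; exists k; split => // ? ? ?; exfalso; exact: nPP.
have [r r01|r r01 P PPP|k reg kF] :=
    exists_calibrated_kernel (J := [set r : rat | 0 < (ratr r : R) < 1])
      (E := fun r => F (ratr r)) (c := ratr) compl suffS PP0.
- exact: mF.
- by rewrite initialF// valid.
exists k; split=> // _ _ _ t e e01 /(FE _ _ e01) Fe.
have kF_le (r : rat) : 0 < (ratr r : R) < 1 ->
  (k (S t) (F (ratr r)) <= (ratr r)%:E)%E by move=> r01; rewrite kF.
apply: le_trans (critical_level_superuniform F_incr mF kF_le e01).
have mcF := measurable_critical_level mF.
apply: le_measure; rewrite ?inE.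
- rewrite -[X in measurable X]setTI; apply: measurable_fun_le => //.
  exact: measurableT_comp ma (@measurable_summary m).
- rewrite -[X in measurable X]setTI; exact: measurable_fun_le.
move=> u /=; rewrite lerN2 => /le_trans; apply.
(* The critical level of E at the summary of t is by definition that of F at
   t. *)
by have := critical_level_le F_incr e01 Fe.
Qed.

End Dominance.

End ConformalPrediction.

Theorem theorem2 (R : realType) (K : nat) (PP : model R K)
    (d : nat -> measure_display) (Sigma : forall n : nat, measurableType (d n))
    (S : forall n : nat, n.-tuple (obs R K) -> Sigma n)
    (hS : ATTS PP S)
    (N : set nat) (hN : forall n : nat, N n -> (0 < n)%N)
    (hcomplete : forall n : nat, N n -> boundedly_complete PP S n)
    (G : predictor R K)
    (hG : confidence_predictor G)
    (hinv : invariant_predictor S G)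
    (hvalid : weakly_valid PP N G) :
  exists G' : predictor R K,
    conformal_predictor PP S G' /\ at_least_as_accurate PP N G' G.
Proof.
have [stats _ suffS] := hS.
have mS n : measurable_fun setT (@S n) by exact: (stats n).1.
pose step m := cid (exists_dominating_pvalue mS hG hinv (suffS m.+1 isT).1).
pose A m := projT1 (step m).
pose k m := projT1 (cid (projT2 (step m))).
have stepP m := projT2 (cid (projT2 (step m))).
have mA : nonconformity_measure A by move=> m; have [] := stepP m.
have reg m : common_regular_conditional PP S (k m) by have [] := stepP m.
exists (conformal_set S k A); split.
  split; first exact: conformal_set_confidence.
  by exists k, A; split.
move=> e e01 m Nm P PPP; apply: aeW => w y /= lt_e; apply: contrapT => nG.
have [_ _ dom] := stepP m.
set t := [tuple of rcons (initial m w) ((w m).1, y)].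
have nGt : ~ G m (past t) (current t).1 e (current t).2.
  by rewrite past_rcons current_rcons.
have := dom (ex_intro _ P PPP) (hcomplete _ Nm)
  (fun P PPP e e01 => hvalid P PPP m Nm e e01) t e e01 nGt.
by rewrite leNgt => /negP; apply; move: lt_e; rewrite /conformal_set /= pvalue1E.
Qed.
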